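(* For every integer $\ell\ge 4$, $m_{\ell-1}(\ell)\leq 2\ell^{\ell-3}$.
   Context: For $S\subset[n]$, $\mathcal F(\overline S)=\{F\in\mathcal F: F\cap S=\emptyset\}$ and $\gamma_j(\mathcal F)=\min_{S\in\binom{[n]}{j}}|\mathcal F(\overline S)|$. $\tau(\mathcal F)$ is the minimum size of a set meeting all members of $\mathcal F$. For $0\le j<k$, $m_j(k)$ is the maximum of $\gamma_j(\mathcal F)$ over all $n$ and all intersecting families $\mathcal F\subset\binom{[n]}{k}$ (any two members intersect) with $\tau(\mathcal F)=k$. *)

(* Defs.v *)
From mathcomp Require Import all_boot.
Set Implicit Arguments. Unset Strict Implicit. Unset Printing Implicit Defensive.

Definition uniform (n k : nat) (F : {set {set 'I_n}}) : Prop :=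
  forall A, A \in F -> #|A| = k.

Definition intersecting (n : nat) (F : {set {set 'I_n}}) : Prop :=
  forall A B, A \in F -> B \in F -> A :&: B != set0.

Definition is_cover (n : nat) (F : {set {set 'I_n}}) (T : {set 'I_n}) : bool :=
  [forall A in F, T :&: A != set0].

(* tau(F): minimum size of a set meeting all members of F
   (default n if no cover exists, i.e. if the empty set is in F) *)
Definition tau (n : nat) (F : {set {set 'I_n}}) : nat :=
  \big[minn/n]_(T : {set 'I_n} | is_cover F T) #|T|.

Definition avoid (n : nat) (F : {set {set 'I_n}}) (S : {set 'I_n}) : {set {set 'I_n}} :=
  [set A in F | [disjoint A & S]].

Definition gamma (n j : nat) (F : {set {set 'I_n}}) : nat :=
  \big[minn/#|F|]_(S : {set 'I_n} | #|S| == j) #|avoid F S|.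

(* Main.v *)
(* Let d be the largest number of members of F through a common (l-1)-set.
   If S is an (l-1)-set and x |: S is in F, then every member avoiding S
   contains x.  Since tau F = l, a set T with fewer than l points misses some
   member B, and all members through T meet B; branching over B bounds the
   number of members through T by l ^ (s - #|T|) times the maximal number
   through an s-set.  If d >= 3, members avoiding a suitable S contain three
   given points; if d = 2, they contain two given points and one branches up to
   (l-1)-sets.  If d <= 1, take distinct A, B in F with a = #|A :&: B| maximal
   (so a <= l - 2), x in A :\: B and S = A :\ x: members avoiding S contain x
   and one of the l - a points of B :\: A, and (a+1)-sets lie in at most one
   member, which gives (l - a) * l ^ (a - 1) <= 2 * l ^ (l - 3). *)
Require Import Defs.
From mathcomp Require Import all_boot.
From mathcomp Require Import zify.

Lemma bigminn_leq (I : finType) (P : pred I) (f : I -> nat) (x0 : nat) (i : I) :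
  P i -> \big[minn/x0]_(j | P j) f j <= f i.
Proof.
rewrite -big_filter => Pi.
have : i \in [seq j <- index_enum I | P j] by rewrite mem_filter Pi mem_index_enum.
elim: [seq _ <- _ | _] => //= j r IH; rewrite inE big_cons => /predU1P[<-|/IH].
  exact: geq_minl.
by apply: leq_trans; apply: geq_minr.
Qed.

Lemma gamma_leq (n j : nat) (F : {set {set 'I_n}}) (S : {set 'I_n}) :
  #|S| = j -> gamma j F <= #|avoid F S|.
Proof. by move=> cS; apply: bigminn_leq; apply/eqP. Qed.

Lemma small_not_cover (n : nat) (F : {set {set 'I_n}}) (T : {set 'I_n}) :
  #|T| < tau F -> exists2 B, B \in F & [disjoint T & B].
Proof.
move=> ltT; have : ~~ is_cover F T.
  by apply: contraTN ltT => covT; rewrite -leqNgt; apply: bigminn_leq.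
rewrite negb_forall => /existsP[B]; rewrite negb_imply negbK setI_eq0.
by case/andP=> FB TB; exists B.
Qed.

Definition through {n : nat} (F : {set {set 'I_n}}) (T : {set 'I_n}) :
  {set {set 'I_n}} := [set A in F | T \subset A].

(** Every member of [G] contains [T] and a point of [Y], so the families through [y |: T] with [y]
    in [Y] cover [G]. Keeping [Y] apart from [B] lets the branching skip points of [B] that [G] is
    known to miss. *)
Lemma card_through_branch {n : nat} {F : {set {set 'I_n}}} {T B Y : {set 'I_n}}
    {d : nat} {G : {set {set 'I_n}}} :
    G \subset through F T -> {in G, forall A, A :&: B != set0} ->
    {in G, forall A, A :&: B \subset Y} ->
    {in Y, forall y, #|through F (y |: T)| <= d} -> #|G| <= #|Y| * d.
Proof.
move=> /subsetP GT meetB GY ledeg.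
have subG : G \subset \bigcup_(y in Y) through F (y |: T).
  apply/subsetP => A GA; have := GT _ GA; rewrite inE => /andP[FA TA].
  have /set0Pn[y yAB] := meetB _ GA.
  apply/bigcupP; exists y; first exact: subsetP (GY _ GA) _ yAB.
  rewrite inE FA subUset sub1set TA andbT.
  by move: yAB; rewrite inE => /andP[].
apply: leq_trans (subset_leq_card subG) _; rewrite -sum_nat_const.
apply: (@leq_trans (\sum_(y in Y) #|through F (y |: T)|)); last exact: leq_sum.
elim/big_rec2: _ => [|y m U _ le]; first by rewrite cards0.
by rewrite (leq_trans (leq_card_setU _ _)) ?leq_add2l.
Qed.

Lemma card_through {n l : nat} {F : {set {set 'I_n}}} {s d : nat} :
    uniform l F -> intersecting F -> tau F = l -> s <= l ->
    (forall U : {set 'I_n}, #|U| = s -> #|through F U| <= d) ->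
  forall T : {set 'I_n}, #|T| <= s -> #|through F T| <= l ^ (s - #|T|) * d.
Proof.
move=> unif inter tauF les degs T leT.
move: {2}(s - #|T|) (erefl (s - #|T|)) => m.
elim: m T leT => [|m IH] T leT eqm; rewrite eqm.
  by rewrite mul1n degs //; lia.
(* Here [#|T| < s <= tau F], so some member [B] misses [T]; each of its [l] points is new to [T],
   and the exponent drops by exactly one. *)
have [|B FB dTB] := small_not_cover _ F T; first lia.
rewrite expnS -mulnA -(unif _ FB).
apply: (card_through_branch (subxx _)) => [A | A _ | y By]; last first.
- have yT : y \notin T.
    by apply: contraTN By => Ty; rewrite (disjointFr dTB Ty).
  have cyT : #|y |: T| = #|T|.+1 by rewrite cardsU1 yT.
  have eqm' : s - #|y |: T| = m by lia.
  by rewrite (unif _ FB) -eqm'; apply: IH; rewrite ?cyT //; lia.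
- exact: subsetIr.
- by rewrite inE => /andP[FA _]; apply: inter.
Qed.

(** For [l]-uniform [F] and [S] of [l - 1] points, these points correspond to the members through
    [S], so their number is the degree of [S]. *)
Definition extensions {n : nat} (F : {set {set 'I_n}}) (S : {set 'I_n}) :
  {set 'I_n} := [set x | x |: S \in F].

(** A member avoiding [S] still meets [x |: S], and can do so only in [x]. *)
Lemma avoid_through {n : nat} {F : {set {set 'I_n}}} {S X : {set 'I_n}} :
  intersecting F -> X \subset extensions F S -> avoid F S \subset through F X.
Proof.
move=> inter /subsetP XS; apply/subsetP => A; rewrite !inE => /andP[FA dAS].
rewrite FA; apply/subsetP => x /XS; rewrite inE => FxS.
have := inter _ _ FA FxS.
rewrite setIUr (disjoint_setI0 dAS) setU0 => /set0Pn[y].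
by rewrite !inE => /andP[Ay /eqP <-].
Qed.

Lemma card_through_extensions {n l : nat} {F : {set {set 'I_n}}}
    {S : {set 'I_n}} :
  uniform l F -> #|S|.+1 = l -> #|through F S| <= #|extensions F S|.
Proof.
move=> unif cS.
apply: leq_trans (leq_imset_card (fun x => x |: S) (extensions F S)).
apply/subset_leq_card/subsetP => A; rewrite inE => /andP[FA SA].
have /cards1P[x AS] : #|A :\: S| == 1.
  by rewrite cardsD (setIidPr SA) (unif _ FA) -cS subSnn.
have Ax : A = x |: S by rewrite -AS setUC setDE setUIr setUCr setIT (setUidPr SA).
by apply/imsetP; exists x => //; rewrite inE -Ax.
Qed.

Lemma through_setI_leq1 {n a : nat} {F : {set {set 'I_n}}} {U : {set 'I_n}} :
    (forall A B, A \in F -> B \in F -> A != B -> #|A :&: B| <= a) ->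
  a < #|U| -> #|through F U| <= 1.
Proof.
move=> maxa ltU; rewrite leqNgt; apply/negP => /card_gt1P[A [B []]].
rewrite !inE => /andP[FA UA] /andP[FB UB] neAB.
have := maxa _ _ FA FB neAB; rewrite leqNgt => /negP; apply.
by apply: leq_trans ltU (subset_leq_card _); rewrite subsetI UA.
Qed.

(** Equality holds at [b = 2]; raising [b] by one multiplies the right side by [l >= 2], while
    [b + 1 <= 2 * b]. *)
Lemma leq_mul_expn (l b : nat) : 1 < l -> 1 < b -> b <= 2 * l ^ (b - 2).
Proof.
move=> l1; case: b => [|[|b]] // _; rewrite subSS subSS subn0.
elim: b => [|b IH] //; rewrite expnS; nia.
Qed.

Lemma max_setI_pair {n l : nat} {F : {set {set 'I_n}}} :
    uniform l F -> tau F = l -> 1 < l ->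
  exists A B, [/\ A \in F, B \in F, A != B &
    forall A' B', A' \in F -> B' \in F -> A' != B' -> #|A' :&: B'| <= #|A :&: B|].
Proof.
move=> unif tauF l1.
have [|A FA _] := small_not_cover _ F set0; first by rewrite cards0; lia.
have /card_gt0P[x Ax] : 0 < #|A| by rewrite (unif _ FA); lia.
(* As [tau F > 1], the point [x] of [A] is missed by some member, necessarily different from [A]. *)
have [|B FB] := small_not_cover _ F [set x]; first by rewrite cards1; lia.
rewrite disjoints1 => Bx.
have neAB : A != B by apply: contraNneq Bx => <-.
pose P (p : {set 'I_n} * {set 'I_n}) := [&& p.1 \in F, p.2 \in F & p.1 != p.2].
have P0 : P (A, B) by rewrite /P FA FB.
case: (arg_maxnP (fun p : {set 'I_n} * {set 'I_n} => #|p.1 :&: p.2|) P0).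
move=> [A1 B1] /and3P[/= FA1 FB1 ne1] maxAB.
exists A1, B1; split=> // A' B' FA' FB' ne'.
by apply: (maxAB (A', B')); rewrite /P /= FA' FB'.
Qed.

Lemma avoid_leq_near_linear {n l : nat} {F : {set {set 'I_n}}} :
    uniform l F -> intersecting F -> tau F = l -> 1 < l ->
    (forall S : {set 'I_n}, #|S|.+1 = l -> #|through F S| <= 1) ->
  exists2 S : {set 'I_n}, #|S|.+1 = l & #|avoid F S| <= 2 * l ^ (l - 3).
Proof.
move=> unif inter tauF l1 deg1.
have [A [B [FA FB neAB maxAB]]] := max_setI_pair unif tauF l1.
have ABgt0 : 0 < #|A :&: B| by rewrite card_gt0 inter.
have leAl : #|A :&: B| <= l - 2.
  (* More than [l - 2] common points would put a set of [l - 1] points inside two members, against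
     [deg1]. *)
  rewrite leqNgt; apply/negP => ltAB.
  have [S SAB cS] : exists2 S : {set 'I_n}, S \subset A :&: B & #|S| = l - 1.
    have : l - 1 <= #|A :&: B| by lia.
    case/card_geqP=> s [us <- ss]; exists [set z in s].
      by apply/subsetP => z; rewrite inE; apply: ss.
    by rewrite cardsE (card_uniqP us).
  have := deg1 S; rewrite cS => /(_ ltac:(lia)); rewrite leqNgt => /negP; apply.
  move: SAB; rewrite subsetI => /andP[SA SB].
  by apply/card_gt1P; exists A, B; rewrite !inE FA FB.
have cAB : #|A :\: B| = l - #|A :&: B| by rewrite cardsD (unif _ FA).
have cBA : #|B :\: A| = l - #|A :&: B| by rewrite cardsD (unif _ FB) setIC.
have /card_gt0P[x] : 0 < #|A :\: B| by rewrite cAB; lia.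
rewrite inE => /andP[Bx Ax].
have cS : #|A :\ x|.+1 = l by rewrite -(unif _ FA) (cardsD1 x A) Ax.
exists (A :\ x) => //.
have avx : avoid F (A :\ x) \subset through F [set x].
  by apply: (avoid_through inter); rewrite sub1set inE setD1K.
have degU : forall U : {set 'I_n}, #|U| = #|A :&: B|.+1 -> #|through F U| <= 1.
  by move=> U cU; apply: through_setI_leq1 maxAB _; rewrite cU.
have lea : #|A :&: B|.+1 <= l by lia.
have deg_pair : {in B :\: A, forall y,
    #|through F (y |: [set x])| <= l ^ (#|A :&: B| - 1)}.
  move=> y; rewrite inE => /andP[Ay By].
  have cyx : #|y |: [set x]| = 2.
    by rewrite cards2; case: eqVneq Ay => // ->; rewrite Ax.
  have := card_through unif inter tauF lea degU (y |: [set x]).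
  by rewrite cyx muln1 subSS; apply; lia.
have := card_through_branch avx _ _ deg_pair.
move=> /(_ B) H; apply: leq_trans (H _ _) _.
- by move=> C; rewrite inE => /andP[FC _]; apply: inter.
(* Such a member meets [B] only outside [A]: it misses [A :\ x], and [x] is not in [B]. *)
- move=> C; rewrite inE => /andP[_ dC]; apply/subsetP => y.
  rewrite !inE => /andP[Cy By]; rewrite By andbT; apply: contraNN Bx => Ay.
  have := disjointFr dC Cy; rewrite !inE Ay andbT => /negbFE /eqP <-.
  exact: By.
rewrite cBA.
(* Writing [a] for [#|A :&: B|], the powers [l ^ (l - a - 2)] and [l ^ (a - 1)] multiply to
   [l ^ (l - 3)]. *)
have leb : l - #|A :&: B| <= 2 * l ^ (l - #|A :&: B| - 2) by apply: leq_mul_expn; lia.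
apply: leq_trans (leq_mul leb (leqnn _)) _.
rewrite -mulnA -expnD.
by have -> : l - #|A :&: B| - 2 + (#|A :&: B| - 1) = l - 3 by lia.
Qed.

Theorem theorem5p3 (l : nat) : 4 <= l ->
  forall (n : nat) (F : {set {set 'I_n}}),
    uniform l F -> intersecting F -> tau F = l ->
    gamma (l - 1) F <= 2 * l ^ (l - 3).
Proof.
move=> l4 n F unif inter tauF.
suff [S cS leS] : exists2 S : {set 'I_n}, #|S|.+1 = l & #|avoid F S| <= 2 * l ^ (l - 3).
  by apply: leq_trans (gamma_leq _ _ _ S _) leS; lia.
case: (boolP [exists S : {set 'I_n}, (#|S|.+1 == l) && (2 < #|extensions F S|)]).
  case/existsP=> S /andP[/eqP cS /card_gt2P[x [y [z [[Sx Sy Sz] [xy yz zx]]]]]].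
  exists S => //.
  have sub : [set x; y; z] \subset extensions F S.
    by rewrite !subUset !sub1set Sx Sy Sz.
  apply: leq_trans (subset_leq_card (avoid_through inter sub)) _.
  have cX : #|[set x; y; z]| = 3.
    by rewrite setUC cardsU1 cards2 !inE xy (negPf zx) eq_sym (negPf yz).
  (* The only member that can contain an [l]-set is that set, so branching from three points up to
     [l] gives [l ^ (l - 3)]. *)
  have deg1 (U : {set 'I_n}) : #|U| = l -> #|through F U| <= 1.
    move=> cU; rewrite -(cards1 U); apply/subset_leq_card/subsetP => A.
    rewrite inE => /andP[FA UA].
    by rewrite inE eq_sym eqEcard UA (unif _ FA) cU leqnn.
  have := card_through unif inter tauF (leqnn l) deg1 [set x; y; z].
  by rewrite cX muln1 => /(_ ltac:(lia)) le; apply: leq_trans le _; lia.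
rewrite negb_exists => /forallP le2.
have ext2 (S : {set 'I_n}) : #|S|.+1 = l -> #|extensions F S| <= 2.
  by move=> cS; have := le2 S; rewrite cS eqxx -leqNgt.
case: (boolP [exists S : {set 'I_n}, (#|S|.+1 == l) && (1 < #|extensions F S|)]).
  case/existsP=> S /andP[/eqP cS /card_gt1P[x [y [Sx Sy xy]]]].
  exists S => //.
  have sub : [set x; y] \subset extensions F S by rewrite !subUset !sub1set Sx Sy.
  apply: leq_trans (subset_leq_card (avoid_through inter sub)) _.
  (* Branching stops at [l - 1] points, where at most two members remain: this yields the factor 2
     and the exponent [(l - 1) - 2]. *)
  have deg2 (U : {set 'I_n}) : #|U| = l - 1 -> #|through F U| <= 2.
    move=> cU; have cU1 : #|U|.+1 = l by lia.
    exact: leq_trans (card_through_extensions unif cU1) (ext2 _ cU1).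
  have := card_through unif inter tauF (leq_subr 1 l) deg2 [set x; y].
  rewrite cards2 xy mulnC -subnDA; apply; lia.
rewrite negb_exists => /forallP le1.
apply: (avoid_leq_near_linear unif inter tauF) => [|S cS]; first lia.
apply: leq_trans (card_through_extensions unif cS) _.
by have := le1 S; rewrite cS eqxx -leqNgt.
Qed.
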